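(* Let $K$ be a compact line (not necessarily separable) and let $L$ be a countable discrete extension of $K$. If $\eta(K,L)<3$, then $L$ has property $(\mathcal{R})$, i.e. there is a continuous retraction from $L$ onto $K$.
   Context: All topological spaces are Hausdorff. A compact line is a compact space whose topology is the order topology of some linear order. A countable discrete extension of a compact space $K$ is a compact space $L\supseteq K$ (containing $K$ as a subspace) such that $L\setminus K$ is a countably infinite discrete set. $C(K)$ is the Banach space of real-valued continuous functions on $K$ with the supremum norm. For compact spaces $K\subseteq L$, an extension operator is a bounded linear operator $E:C(K)\to C(L)$ such that $(Ef)|_K=f$ for every $f\in C(K)$. $\eta(K,L)$ denotes the infimum of the norms of all extension operators $E:C(K)\to C(L)$, with $\eta(K,L)=\infty$ if there is no such (bounded) operator. $L$ has property $(\mathcal{R})$ if there is a continuous retraction from $L$ onto $K$. *)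

(* Defs.v *)
From HB Require Import structures.
From mathcomp Require Import all_boot all_order all_algebra.
From mathcomp Require Import all_classical all_reals all_analysis.

Set Implicit Arguments.
Unset Strict Implicit.
Unset Printing Implicit Defensive.

Import Order.TTheory GRing.Theory Num.Theory.
Import numFieldNormedType.Exports.

Local Open Scope classical_set_scope.
Local Open Scope ring_scope.

(* The equation says that [X], as a topological space, underlies a linearly
   ordered type whose open intervals and open rays form neighbourhood bases.
   The Hausdorff property is automatic ([order_hausdorff]). *)
Definition compact_line (X : topologicalType) : Prop :=
  compact [set: X] /\
  exists (d : Order.disp_t) (T : orderTopologicalType d),
    X = T :> topologicalType.

(* The extended space is the whole type [L]; the set [K], seen as a type,
   carries the topology induced by [L]. *)
Definition countable_discrete_extension (L : topologicalType) (K : set L) :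
    Prop :=
  [/\ hausdorff_space L, compact [set: L], compact K,
      (~` K #= [set: nat])%card & ~` K `<=` isolated (~` K)].

Section continuous_functions.
Context (R : realType) (X : topologicalType).
Local Notation C := (continuousType X R).
Implicit Types f g : C.

Let zeroC : C := @cst X R 0.

Let oppC_subproof f : continuous (fun x => - f x).
Proof. by move=> x; apply: cvgN; exact: cts_fun. Qed.
Let oppC f : C := mkcts (@oppC_subproof f).

Let addC_subproof f g : continuous (fun x => f x + g x).
Proof. by move=> x; apply: cvgD; exact: cts_fun. Qed.
Let addC f g : C := mkcts (@addC_subproof f g).

Let scaleC_subproof (a : R) f : continuous (fun x => a * f x).
Proof. by move=> x; apply: cvgM; [exact: cvg_cst|exact: cts_fun]. Qed.
Let scaleC (a : R) f : C := mkcts (@scaleC_subproof a f).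

Let addCA : associative addC.
Proof. by move=> f g h; apply/continuousEP => x; exact: addrA. Qed.
Let addCC : commutative addC.
Proof. by move=> f g; apply/continuousEP => x; exact: addrC. Qed.
Let add0C : left_id zeroC addC.
Proof. by move=> f; apply/continuousEP => x; exact: add0r. Qed.
Let addNC : left_inverse zeroC oppC addC.
Proof. by move=> f; apply/continuousEP => x; exact: addNr. Qed.

HB.instance Definition _ := GRing.isZmodule.Build C addCA addCC add0C addNC.

Let scaleCA (a b : R) f : scaleC a (scaleC b f) = scaleC (a * b) f.
Proof. by apply/continuousEP => x; exact: mulrA. Qed.
Let scale1C : left_id 1 scaleC.
Proof. by move=> f; apply/continuousEP => x; exact: mul1r. Qed.
Let scaleCDr : right_distributive scaleC +%R.
Proof. by move=> a f g; apply/continuousEP => x; exact: mulrDr. Qed.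
Let scaleCDl f : {morph scaleC^~ f : a b / a + b}.
Proof. by move=> a b; apply/continuousEP => x; exact: mulrDl. Qed.

HB.instance Definition _ :=
  GRing.Zmodule_isLmodule.Build R C scaleCA scale1C scaleCDr scaleCDl.

Lemma ctsD f g x : (f + g) x = f x + g x. Proof. by []. Qed.
Lemma ctsN f x : (- f) x = - f x. Proof. by []. Qed.
Lemma ctsZ (a : R) f x : (a *: f) x = a * f x. Proof. by []. Qed.

(* For compact [X] the supremum is that of a bounded set; it is 0 if [X] is
   empty. *)
Definition supnorm f : R := sup (range (fun x => `|f x|)).

End continuous_functions.

Section operators.
Context (R : realType) (X Y : topologicalType).
Implicit Type E : {linear continuousType X R -> continuousType Y R}.

Definition bounded_operator E : Prop :=
  exists M : R, forall f, supnorm (E f) <= M * supnorm f.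

Definition opnorm E : \bar R :=
  ereal_sup [set (supnorm (E f))%:E | f in [set f | supnorm f <= 1]].

End operators.

Section extensions.
Context (L : topologicalType) (K : set L).

Definition extension_operator (R : realType)
    (E : {linear continuousType K R -> continuousType L R}) : Prop :=
  bounded_operator E /\
  forall (f : continuousType K R) (x : K), E f (set_val x) = f x.

(* The infimum of the empty set is +oo. *)
Definition eta (R : realType) : \bar R :=
  ereal_inf [set opnorm E | E in @extension_operator R].

Definition property_R : Prop :=
  exists r : L -> K, continuous r /\ cancel set_val r.

End extensions.

(* Main.v *)
Require Import Defs.
From mathcomp Require Import all_boot all_order all_algebra.
From mathcomp Require Import all_classical all_reals all_analysis.
From mathcomp Require Import lra.
(* Let [E : C(K) -> C(L)] be an extension operator with [||E|| <= c < 3] and fix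
   [e > 0] with [5e < 3 - c]. For [y] in [L], let [r(y)] be the supremum of the
   [b] in [K] such that [E f y <= e] for some [0 <= f <= 1] equal to [1] on
   [{t < b}]. If [0 <= f <= g <= 1], then [1 + 2f - 2g] has norm at most [1], so
   at the points where [E 1 > 1 - e] one cannot have [E f > 1 - e] and
   [E g <= e] together. This quasi-monotonicity bounds [r(y)] from above for [y]
   near a point [x] of [K], using a Urysohn function equal to [1] at [x] and
   to [0] slightly to its right; a Urysohn function equal to [1] slightly to the
   left of [x] and to [0] at [x] bounds [r(y)] from below. So [r] is continuous
   at [x], and [r(x) = x]; at the points outside [K] there is nothing to prove
   since they are isolated in [L]. *)
Set Implicit Arguments.
Unset Strict Implicit.
Unset Printing Implicit Defensive.

Import Order.TTheory GRing.Theory Num.Theory.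
Import numFieldNormedType.Exports.

Local Open Scope classical_set_scope.
Local Open Scope ring_scope.

(** An injective sequence would cluster at some [p], yet it takes the value [p] at most once and so
    eventually leaves the open set of [p] alone. *)
Lemma compact_open_points_finite (X : topologicalType) :
  compact [set: X] -> (forall x : X, nbhs x [set x]) -> finite_set [set: X].
Proof.
move=> cX oX; apply: contrapT => /infiniteP/card_leP[h].
pose g (n : nat) : X := set_val (h (SigSub (in_setT n))).
have g_inj : injective g.
  by move=> m n /val_inj/(@inj _ _ _ h _ _ (in_setT _) (in_setT _))[].
have [p [_ clp]] := cX (g @ \oo) _ filterT.
have : (g @ \oo) [set~ p].
  have [[n gn]|np] := pselect (exists n, g n = p); last first.
    by exists 0%N => // k _ /= gk; apply: np; exists k.
  by exists n.+1 => // k /= nk; rewrite -gn => /g_inj kn; rewrite kn ltnn in nk.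
by move=> /clp/(_ (oX p))[x []].
Qed.

(** * Compact order topologies: suprema and separating functions *)

Section order_topology.
Context (d : Order.disp_t) (T : orderTopologicalType d).
Implicit Types a b x t : T.

Lemma near_lt x b : (x < b)%O -> \forall t \near x, (t < b)%O.
Proof. by move=> xb; apply: (open_nbhs_nbhs (conj (lray_open b) _)). Qed.

Lemma near_gt a x : (a < x)%O -> \forall t \near x, (a < t)%O.
Proof.
move=> ax; apply: filterS (open_nbhs_nbhs (conj (rray_open a) _)).
  by move=> t /=; rewrite in_itv/= andbT.
by rewrite /= in_itv/= ax.
Qed.

Lemma cvg_order U (F : set_system U) (f : U -> T) x : Filter F ->
  (forall a, (a < x)%O -> \forall u \near F, (a < f u)%O) ->
  (forall b, (x < b)%O -> \forall u \near F, (f u < b)%O) ->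
  f u @[u --> F] --> x.
Proof.
move=> FF lo hi W; rewrite itv_nbhsE => -[[l r] [+ +] sub].
case: l r sub => [[] a|[]] [[] b|[]] //= sub _; rewrite in_itv /=.
- move=> /andP[/lo ax /hi xb]; near=> u; apply: sub; rewrite /= in_itv /=.
  by apply/andP; split; near: u.
- rewrite andbT => /lo ax; near=> u; apply: sub; rewrite /= in_itv /= andbT.
  by near: u.
- by move=> /hi xb; near=> u; apply: sub; rewrite /= in_itv /=; near: u.
- by move=> _; near=> u; apply: sub.
Unshelve. all: by end_near. Qed.

Lemma compact_order_min : compact [set: T] -> [set: T] !=set0 ->
  exists m, forall t, (m <= t)%O.
Proof.
move=> cT [t0 _].
pose F : set_system T := filter_from [set: T] (fun a t => (t <= a)%O).
have FF : ProperFilter F.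
  apply: filter_from_proper; last by move=> a _; exists a => /=.
  apply: filter_from_filter; first by exists t0.
  move=> a b _ _; exists (Order.min a b) => // t /=.
  by rewrite le_min => /andP[].
have [p [_ clp]] := cT F _ filterT.
exists p => t; rewrite leNgt; apply/negP => tp.
have Ft : F [set u | (u <= t)%O] by exists t.
have [u [/= ut]] := clp _ _ Ft (near_gt tp).
by rewrite ltNge ut.
Qed.

(** The final segments of [A] generate a filter, and any cluster point of it is the supremum; for
    empty [A] the supremum is the least element. *)
Lemma compact_order_supremum (A : set T) : compact [set: T] ->
  [set: T] !=set0 -> supremums A !=set0.
Proof.
move=> cT T0; have [A0|/set0P[a0 Aa0]] := eqVneq A set0.
  have [m mP] := compact_order_min cT T0.
  by exists m; rewrite A0; split=> [t []|t _]; exact: mP.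
pose F : set_system T := filter_from A (fun a t => A t /\ (a <= t)%O).
have FF : ProperFilter F.
  apply: filter_from_proper; last by move=> a Aa; exists a => /=.
  apply: filter_from_filter; first by exists a0.
  move=> a b Aa Ab; exists (Order.max a b).
    by rewrite /Order.max; case: ifP.
  by move=> t /= [At]; rewrite ge_max => /andP[].
have [p [_ clp]] := cT F _ filterT.
exists p; split.
  move=> a Aa /=; rewrite leNgt; apply/negP => pa.
  have Fa : F [set t | A t /\ (a <= t)%O] by exists a.
  have [u [/= [_ au]]] := clp _ _ Fa (near_lt pa).
  by rewrite ltNge au.
move=> u Au /=; rewrite leNgt; apply/negP => up.
have FA : F A by exists a0 => // t [].
have [t [/Au/= tu]] := clp _ _ FA (near_gt up).
by rewrite ltNge tu.
Qed.

Lemma compact_order_urysohn (R : realType) (A B : set T) :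
  compact [set: T] -> closed A -> closed B -> A `&` B = set0 ->
  exists f : continuousType T R, [/\ forall t, 0 <= f t <= 1,
    forall t, A t -> f t = 0 & forall t, B t -> f t = 1].
Proof.
move=> cT cA cB AB0; have nT := compact_normal (@order_hausdorff _ T) cT.
have [f [cf fA fB f01]] := urysohn_ext_itv nT cA cB AB0 (@ltr01 R).
exists (mkcts cf); split=> t.
- by have := f01 (f t) (imageT f t); rewrite /= in_itv.
- by move=> At; apply: fA; exists t.
- by move=> Bt; apply: fB; exists t.
Qed.

(** Allowing [b = x] covers a jump of the order at [x], where no point lies strictly between [a] and
    [x]. *)
Lemma order_separation_left (R : realType) a x : compact [set: T] -> (a < x)%O ->
  exists b, [/\ (a < b)%O, (b <= x)%O & exists f : continuousType T R,
    [/\ forall t, 0 <= f t <= 1, forall t, (t < b)%O -> f t = 1 & f x = 0]].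
Proof.
move=> cT ax.
have sep c : (c < x)%O -> exists f : continuousType T R,
    [/\ forall t, 0 <= f t <= 1, forall t, (t <= c)%O -> f t = 1 & f x = 0].
  move=> cx; have [|f [f01 fx fc]] := @compact_order_urysohn R _ _ cT
    (@accessible_closed_set1 _ (hausdorff_accessible (@order_hausdorff _ T)) x)
    (@lray_closed _ _ c).
    by apply/seteqP; split=> // t [/= ->]; rewrite in_itv /= leNgt cx.
  by exists f; split=> [|t tc|]; [exact: f01|apply: fc; rewrite /= in_itv|exact: fx].
have [[c /andP[ac cx]]|ncut] := pselect (exists c, (a < c < x)%O).
  have [f [f01 fc fx]] := sep _ cx; exists c; split=> //; first exact: ltW.
  by exists f; split=> // t /ltW; exact: fc.
(* Here [a] and [x] are adjacent, so [t < x] amounts to [t <= a]. *)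
have [f [f01 fa fx]] := sep _ ax; exists x; split=> //.
exists f; split=> // t tx; apply: fa; rewrite leNgt; apply/negP => at_.
by apply: ncut; exists t; rewrite at_.
Qed.

Lemma order_separation_right (R : realType) x b : compact [set: T] -> (x < b)%O ->
  exists c, [/\ (x <= c)%O, (c < b)%O & exists f : continuousType T R,
    [/\ forall t, 0 <= f t <= 1, f x = 1 & forall t, (c < t)%O -> f t = 0]].
Proof.
move=> cT xb.
have sep c : (x < c)%O -> exists f : continuousType T R,
    [/\ forall t, 0 <= f t <= 1, f x = 1 & forall t, (c <= t)%O -> f t = 0].
  move=> xc; have [|f [f01 fc fx]] := @compact_order_urysohn R _ _ cT
    (@rray_closed _ _ c)
    (@accessible_closed_set1 _ (hausdorff_accessible (@order_hausdorff _ T)) x).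
    by apply/seteqP; split=> // t [/= + tx]; rewrite tx in_itv /= leNgt xc.
  exists f; split=> // [|t ct]; first exact: fx.
  by apply: fc; rewrite /= in_itv /= ct.
have [[c /andP[xc cb]]|ncut] := pselect (exists c, (x < c < b)%O).
  have [f [f01 fx fc]] := sep _ xc; exists c; split=> //; first exact: ltW.
  by exists f; split=> // t /ltW; exact: fc.
have [f [f01 fx fb]] := sep _ xb; exists x; split=> //.
exists f; split=> // t xt; apply: fb; rewrite leNgt; apply/negP => tb.
by apply: ncut; exists t; rewrite xt.
Qed.

End order_topology.

(** * Pointwise bounds from the supremum norm and the operator norm *)

Section supnorm.
Context (R : realType) (X : topologicalType).
Implicit Type f : continuousType X R.

Lemma supnorm_le f c : 0 <= c -> (forall x, `|f x| <= c) -> supnorm f <= c.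
Proof.
move=> c0 fc; rewrite /supnorm.
have [->|/set0P fX0] := eqVneq (range (fun x => `|f x|)) set0.
  by rewrite sup0.
by apply: ge_sup => // _ [x _ <-].
Qed.

Lemma normr_le_supnorm f x : compact [set: X] -> `|f x| <= supnorm f.
Proof.
move=> cX; apply: ub_le_sup; last by exists x.
have cf : {within [set: X], continuous f}.
  by apply: continuous_subspaceT; exact: cts_fun.
have [M [_ fM]] := compact_bounded (continuous_compact cf cX).
by exists (M + 1) => _ [y _ <-]; apply: (fM (M + 1)); [rewrite ltrDl | exists y].
Qed.

End supnorm.

Lemma opnorm_lt (R : realType) (X Y : topologicalType)
    (E : {linear continuousType X R -> continuousType Y R}) (m : R) :
  compact [set: Y] -> (opnorm E < m%:E)%E ->
  exists2 c : R, c < m & forall f : continuousType X R,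
    (forall x, `|f x| <= 1) -> forall y, `|E f y| <= c.
Proof.
move=> cY Em.
have [c cm Ec] : exists2 c : R, c < m & (opnorm E <= c%:E)%E.
  case: (opnorm E) Em => [r|//|_]; first by rewrite lte_fin; exists r.
  by exists (m - 1); rewrite ?leNye// gtrDl oppr_lt0.
exists c => // f f1 y; apply: le_trans (normr_le_supnorm _ _ cY) _.
rewrite -lee_fin; apply: le_trans Ec; apply: ereal_sup_ubound.
by exists f => //; exact: supnorm_le.
Qed.

(** * The retraction built from an extension operator *)

Section retraction.
Context (R : realType) (d : Order.disp_t) (T : orderTopologicalType d).
Context (L : topologicalType).
Variable E : {linear continuousType T R -> continuousType L R}.
Implicit Types (f g h : continuousType T R) (y z : L).

Let oneC : continuousType T R := @cst T R 1.

Lemma extension_quasi_monotone (c e : R) f g y :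
  (forall h, (forall t : T, `|h t| <= 1) -> forall z, `|E h z| <= c) ->
  5 * e < 3 - c -> (forall t, 0 <= f t) -> (forall t, g t <= 1) ->
  (forall t, f t <= g t) ->
  1 - e < E oneC y -> 1 - e < E f y -> e < E g y.
Proof.
move=> Ec ec f0 g1 fg E1 Ef; rewrite ltNge; apply/negP => Eg.
have h1 t : `|(oneC + 2 *: f - 2 *: g) t| <= 1.
  have := f0 t; have := g1 t; have := fg t.
  rewrite !(ctsD, ctsN, ctsZ) /= => *; rewrite ler_norml; lra.
(* With [E g y <= e] this value exceeds [(1 - e) + 2 * (1 - e) - 2 * e = 3 - 5 * e], which is more
   than [c]. *)
have := Ec _ h1 y; rewrite !(linearD, linearN, linearZ) /=.
by rewrite !(ctsD, ctsN, ctsZ) ler_norml => /andP[_]; lra.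
Qed.

(** The strict [t < b] lets [x] itself belong to the cut of points near [x] when [x] has an
    immediate predecessor. *)
Let cut (e : R) (y : L) : set T := [set b | exists f,
  [/\ forall t, 0 <= f t <= 1, forall t, (t < b)%O -> f t = 1 & E f y <= e]].

Lemma retraction_of_extension (i : T -> L) (c : R) :
  compact [set: T] -> [set: T] !=set0 ->
  (forall f t, E f (i t) = f t) ->
  c < 3 -> (forall h, (forall t : T, `|h t| <= 1) -> forall z, `|E h z| <= c) ->
  (forall y, range i y \/ nbhs y [set y]) ->
  exists r : L -> T, continuous r /\ cancel i r.
Proof.
move=> cT T0 Ei c3 Ec isoL.
have [e e0 ec] : exists2 e : R, 0 < e & 5 * e < 3 - c.
  by exists ((3 - c) / 6); lra.
have /choice[r rP] : forall y, exists s, supremums (cut e y) s.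
  by move=> y; exact: compact_order_supremum.
have nearE f x (u : R) : f x < u -> \forall y \near i x, E f y < u.
  by move=> fu; apply: (cvgr_lt (E f (i x))); [exact: cts_fun|rewrite Ei].
have nearE' f x (u : R) : u < f x -> \forall y \near i x, u < E f y.
  by move=> fu; apply: (cvgr_gt (E f (i x))); [exact: cts_fun|rewrite Ei].
have r_gt a x : (a < x)%O -> \forall y \near i x, (a < r y)%O.
  move=> /(order_separation_left R cT)[b [ab bx [f [f01 fb fx]]]].
  have : f x < e by rewrite fx.
  (* For [y] near [i x], [f] witnesses that [b] is in [cut e y], so [a < b <= r y]. *)
  move=> /nearE; apply: filterS => y fy; apply: (lt_le_trans ab).
  by have [+ _] := rP y; apply; exists f; split=> //; exact: ltW.
have r_lt b x : (x < b)%O -> \forall y \near i x, (r y < b)%O.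
  move=> /(order_separation_right R cT)[t [xt tb [f [f01 fx ft]]]].
  have fe : 1 - e < f x by rewrite fx gtrDl oppr_lt0.
  have e1 : 1 - e < oneC x by rewrite gtrDl oppr_lt0.
  (* The neighbourhood of [i x] is chosen from [f] alone, so it serves all [s] and [g] at once. *)
  near=> y; apply: le_lt_trans tb; have [_] := rP y; apply=> s [g [g01 gs gy]] /=.
  rewrite leNgt; apply/negP => ts; suff : e < E g y by rewrite ltNge gy.
  apply: (extension_quasi_monotone Ec ec (f := f)).
  - by move=> u; case/andP: (f01 u).
  - by move=> u; case/andP: (g01 u).
  (* Below [s], [g] is 1; from [s] on, [f] is 0 because [t < s]. *)
  - move=> u; have [us|su] := ltP u s; first by rewrite gs//; case/andP: (f01 u).
    by rewrite ft ?(lt_le_trans ts)//; case/andP: (g01 u).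
  - by near: y; exact: nearE'.
  - by near: y; exact: nearE'.
have ri : cancel i r.
  (* Both estimates are read at the point [i x] itself, with [r (i x)] as the bound. *)
  move=> x; apply/eqP; rewrite eq_le !leNgt; apply/andP; split; apply/negP.
    by move=> xr; have := nbhs_singleton (r_lt _ _ xr); rewrite ltxx.
  by move=> rx; have := nbhs_singleton (r_gt _ _ rx); rewrite ltxx.
exists r; split=> // y; have [[x _ <-]|yy] := isoL y.
  by rewrite /continuous_at ri; apply: cvg_order => [a /r_gt|b /r_lt].
by move=> W /nbhs_singleton Wy; apply: filterS yy => _ ->.
Unshelve. all: by end_near. Qed.

End retraction.

(** A variable [X] with a map [i] replaces the subspace [K], so that the equation in [compact_line]
    can be substituted. *)
Lemma retraction_of_eta (R : realType) (L X : topologicalType) (i : X -> L)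
    (E : {linear continuousType X R -> continuousType L R}) :
  compact_line X -> [set: X] !=set0 -> compact [set: L] ->
  (forall y, range i y \/ nbhs y [set y]) ->
  (forall f x, E f (i x) = f x) -> (opnorm E < 3%:E)%E ->
  exists r : L -> X, continuous r /\ cancel i r.
Proof.
move=> [cX [d [T XT]]]; subst X => X0 cL isoL Ei.
by move=> /(opnorm_lt cL)[c c3 Ec]; exact: retraction_of_extension Ei c3 Ec isoL.
Qed.

Theorem theorem3p2 (R : realType) (L : topologicalType) (K : set L) :
  compact_line K -> countable_discrete_extension K ->
  (eta K R < 3%:E)%E -> property_R K.
Proof.
move=> lineK [hL cL cK cardK isoK] /ereal_inf_lt[_ [E [_ EK] <-] E3].
have isoL y : range (set_val : K -> L) y \/ nbhs y [set y].
  have [Ky|nKy] := pselect (K y).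
    by left; exists (SigSub (mem_set Ky)).
  (* A point isolated in the complement of [K] is isolated in [L], since [K] is closed. *)
  right; have [_ [V nV VK]] := isoK _ nKy; rewrite -VK.
  apply: filterI => //; apply: open_nbhs_nbhs; split=> //.
  by rewrite openC; exact: compact_closed.
apply: (retraction_of_eta lineK _ cL isoL EK E3).
(* If [K] were empty, [L] would be compact with all points isolated, hence finite, against the
   infinite complement of [K]. *)
apply/set0P/eqP => K0.
have /eqP nK : K == set0.
  apply/eqP; rewrite -subset0 => y Ky.
  by have := imageT id (SigSub (mem_set Ky) : K); rewrite image_id K0.
have : finite_set (~` K).
  rewrite nK setC0; apply: compact_open_points_finite => // x.
  by case: (isoL x) => // -[y _ _]; have := mem_set (I : [set: K] y); rewrite K0 inE.
by rewrite (eq_finite_set cardK); exact: infinite_nat.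
Qed.
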